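(* $\lim_{n \to \infty} c(L_{n,n}) \le \frac{1}{\arctan(3/4)} \approx 1.554$.
   Context: For a positive integer $h$ and a finite simple graph $G$ with $n$ vertices and $k$ connected components, fix one vertex in each connected component of $G$, and let $\mathrm{Lip}(G;h)$ be the set of functions $f: V(G) \to \mathbb{Z}$ such that $f$ takes the value $0$ at each of the fixed vertices and $|f(x)-f(y)| \le h$ for every edge $\{x,y\} \in E(G)$. The cardinality $|\mathrm{Lip}(G;h)|$ does not depend on the choice of fixed vertices. If $k < n$, define $c(G) = \lim_{h\to\infty} \frac{1}{h}\,|\mathrm{Lip}(G;h)|^{1/(n-k)}$ (limit over positive integers $h$; this limit exists). $L_{m,n}$ denotes the $m \times n$ grid graph, i.e. the graph Cartesian product of a path on $m$ vertices and a path on $n$ vertices. *)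

(* Defs.v *)
From HB Require Import structures.
From mathcomp Require Import all_boot all_order all_algebra.
From mathcomp Require Import finmap.
From mathcomp Require Import all_classical all_reals all_analysis.

Set Implicit Arguments.
Unset Strict Implicit.
Unset Printing Implicit Defensive.

Import Order.TTheory GRing.Theory Num.Theory.
Import numFieldNormedType.Exports.

Local Open Scope classical_set_scope.
Local Open Scope ring_scope.

Record sgraph := SGraph {
  vertex :> finType;
  edge : rel vertex;
  edge_sym : symmetric edge;
  edge_irrefl : irreflexive edge }.

Arguments edge {s} : rename.

Definition path_edge (n : nat) : rel 'I_n :=
  fun i j => (i.+1 == j :> nat) || (j.+1 == i :> nat).

Lemma path_edge_sym n : symmetric (@path_edge n).
Proof. by move=> i j; rewrite /path_edge orbC. Qed.

Lemma path_edge_irrefl n : irreflexive (@path_edge n).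
Proof. by move=> i; rewrite /path_edge orbb eqn_leq ltnn. Qed.

Definition path_graph (n : nat) : sgraph :=
  SGraph (@path_edge_sym n) (@path_edge_irrefl n).

Definition box_edge (G H : sgraph) : rel (G * H)%type :=
  fun x y => (x.1 == y.1) && edge x.2 y.2 || (x.2 == y.2) && edge x.1 y.1.

Lemma box_edge_sym G H : symmetric (@box_edge G H).
Proof.
move=> x y; rewrite /box_edge.
by rewrite (edge_sym x.1) (edge_sym x.2) (eq_sym x.1) (eq_sym x.2).
Qed.

Lemma box_edge_irrefl G H : irreflexive (@box_edge G H).
Proof. by move=> x; rewrite /box_edge !edge_irrefl !andbF. Qed.

Definition cartesian_product (G H : sgraph) : sgraph :=
  SGraph (@box_edge_sym G H) (@box_edge_irrefl G H).

Definition grid (m n : nat) : sgraph :=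
  cartesian_product (path_graph m) (path_graph n).

Definition one_per_component (G : sgraph) (S : {set G}) : Prop :=
  forall x : G, exists! y : G, y \in S /\ connect edge x y.

Arguments one_per_component : clear implicits.

Definition Lip (G : sgraph) (S : {set G}) (h : nat) : set {ffun G -> int} :=
  [set f : {ffun G -> int} |
           (forall x, x \in S -> f x = 0) /\
           (forall x y, edge x y -> `|f x - f y| <= h%:Z)].

(* [fset_set] has its intended meaning only on finite sets; [Lip S h] is finite
   as soon as [S] meets every component of [G]. *)
Definition card_Lip (G : sgraph) (S : {set G}) (h : nat) : nat :=
  #|` fset_set (Lip S h) |%fset.

(* The term at [h = 0], where [0^-1 = 0], does not affect the limit.  The value
   is only meaningful for graphs with at least one edge, for which the natural
   number subtraction below is positive. *)
Definition lip_const (R : realType) (G : sgraph) (S : {set G}) : R :=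
  limn (fun h : nat =>
    h%:R^-1 * (card_Lip S h)%:R `^ (#|G| - n_comp edge G)%:R^-1 : R).

Arguments lip_const : clear implicits.

(* Main.v *)
Require Import Defs.
From mathcomp Require Import all_boot all_order all_algebra.
From mathcomp Require Import finmap zify ring lra.
From mathcomp Require Import all_classical all_reals all_analysis.
Import Order.TTheory GRing.Theory Num.Theory.
Import numFieldNormedType.Exports.
Local Open Scope classical_set_scope.
Local Open Scope ring_scope.

(* Existence. Dividing a function by k and keeping the remainders shows that
   |Lip(G; H)| <= k^d |Lip(G; h)| for H <= k h, where d = |V| - 1, so the
   normalized counts converge to their infimum. Cutting a grid into two grids
   costs a factor 2h + 1, so (2h + 1) |Lip| is submultiplicative in each side
   length, and the same almost-monotonicity argument applies to the logarithm
   of the volume per vertex.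

   Upper bound. Given one row a of the grid, the next row b is a path of
   integers with |b_i - b_(i+1)| <= h and b_i in a window of 2h + 1 integers
   around a_i. A discrete Riesz rearrangement inequality shows that centring
   all windows can only increase the number of such paths. For centred windows
   the transfer operator is, after rescaling, the kernel |x - y| <= 1 on
   [-1, 1], whose top eigenvalue is 1 / arctan(3/4), with eigenfunction
   cos(omega |x|) - sin(omega |x|) / 2 for omega = arctan(3/4). *)

(** * Counting Lipschitz functions *)

(** For infinite [A] the default value of [fset_set] is the empty set and the bound is trivial;
    otherwise [f] injects [A] into [s]. *)
Lemma card_fset_set_le (T : choiceType) (U : eqType) (A : set T) (f : T -> U)
    (s : seq U) :
  (forall x, A x -> f x \in s) ->
  (forall x y, A x -> A y -> f x = f y -> x = y) ->
  (#|` fset_set A|%fset <= size s)%N.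
Proof.
move=> fs finj; case: (pselect (finite_set A)) => [finA|]; last first.
  by move=> infA; rewrite /fset_set; case: pselect.
have inA x : x \in fset_set A -> A x by rewrite in_fset_set // inE.
rewrite -(size_map f); apply: uniq_leq_size.
  rewrite map_inj_in_uniq ?fset_uniq // => x y /inA Ax /inA Ay; exact: finj.
by move=> _ /mapP[x /inA Ax ->]; apply: fs.
Qed.

Lemma size_le_card_fset_set (T : choiceType) (A : set T) (s : seq T) :
  finite_set A -> uniq s -> (forall x, x \in s -> A x) ->
  (size s <= #|` fset_set A|%fset)%N.
Proof.
move=> finA us sA; apply: uniq_leq_size => // x /sA Ax.
by rewrite in_fset_set // inE.
Qed.

Definition connected_graph (G : sgraph) := forall x y : G, connect edge x y.

Lemma Lip_dist (G : sgraph) (S : {set G}) h f x p : Lip S h f ->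
  path edge x p -> `|f x - f (last x p)| <= (h * size p)%:Z.
Proof.
move=> [_ Lf]; elim: p x => [|y p IH] x /=; first by rewrite subrr muln0.
case/andP => /Lf xy /IH; move: xy; set a := f x; set b := f y; set c := f _.
lia.
Qed.

(** A simple path from [s] has fewer than [#|G|] edges, so all values lie in [[-K, K]]; shifted by
    [K] they become ordinals. *)
Lemma finite_Lip (G : sgraph) (S : {set G}) (s : G) h :
  connected_graph G -> s \in S -> finite_set (Lip S h).
Proof.
move=> conG sS; pose K := (h * #|G|)%N.
apply: (@sub_finite_set _ _
  ((fun g : {ffun G -> 'I_(2 * K).+1} => [ffun x => (g x)%:Z - K%:Z]) @` setT));
  last by apply: finite_image; exact: finite_finset.
move=> f Lf; have fK x : `|f x| <= K%:Z.
  have /connectP[p0 p0P xp0] := conG s x; rewrite xp0.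
  case/shortenP: p0P => p pP up _.
  have := Lip_dist _ _ _ _ _ _ Lf pP; rewrite (Lf.1 s sS).
  have : (size (s :: p) <= #|G|)%N by rewrite -(card_uniqP up) max_card.
  set a := f _; rewrite /K /= => /ltnW /(leq_mul (leqnn h)); lia.
exists [ffun x => inord (absz (f x + K%:Z))] => //.
apply/ffunP => x; rewrite !ffunE inordK; have := fK x; lia.
Qed.

Arguments finite_Lip [G S] s h.

Lemma one_per_component_set1 (G : sgraph) (S : {set G}) (x0 : G) :
  connected_graph G -> one_per_component G S -> exists s, S = [set s]%SET.
Proof.
move=> conG hS; have [s [[sS _] us]] := hS x0; exists s.
apply/setP => y; rewrite inE; apply/idP/eqP => [yS|->//].
by apply/esym/us; split.
Qed.

Lemma n_comp_connected (G : sgraph) (x0 : G) :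
  connected_graph G -> n_comp edge G = 1%N.
Proof.
move=> conG; have sym : connect_sym (@edge G) by move=> x y; rewrite !conG.
rewrite -(n_comp_connect sym x0).
by apply: eq_n_comp_r => y; rewrite !inE conG.
Qed.

(** Subtracting [f t] moves the root to [t]; since [f s = 0], the new value at [s] recovers the
    subtracted constant. *)
Lemma card_Lip_root (G : sgraph) (s t : G) h : connected_graph G ->
  (card_Lip [set s]%SET h <= card_Lip [set t]%SET h)%N.
Proof.
move=> conG; have finL := finite_Lip t h conG (finset.set11 t).
apply: (@card_fset_set_le _ _ (Lip [set s]%SET h)
  (fun f => [ffun x => f x - f t]) (fset_set (Lip [set t]%SET h))).
  move=> f [_ Lf]; rewrite /= in_fset_set // inE; split.
    by move=> x /finset.set1P ->; rewrite ffunE subrr.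
  by move=> x y /Lf; rewrite !ffunE; congr (_ <= _); congr `|_|; ring.
move=> f g [f0 _] [g0 _] /ffunP fg; apply/ffunP => x.
have := fg s; rewrite !ffunE (f0 s) ?(g0 s) ?set11 //.
by have := fg x; rewrite !ffunE; lia.
Qed.

(** Values at most [H <= k * h] apart have quotients by [k] at most [h] apart. The remainders take
    [k] values at each vertex other than the root, where [f] vanishes. *)
Lemma card_Lip_scale (G : sgraph) (s : G) (h H k : nat) : connected_graph G ->
  (0 < k)%N -> (H <= k * h)%N ->
  (card_Lip [set s]%SET H <= card_Lip [set s]%SET h * k ^ #|G|.-1)%N.
Proof.
move=> conG k0 Hk; have finL := finite_Lip s h conG (finset.set11 s).
case: k k0 Hk => // k _ Hk.
pose U := {ffun {x | x != s} -> 'I_k.+1}.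
have -> : (k.+1 ^ #|G|.-1 = #|U|)%N.
  by rewrite card_ffun card_ord card_sig (cardC1 s).
rewrite cardE /card_Lip -(size_allpairs pair).
pose d := k.+1%:Z; have d0 : d != 0 by lia.
pose F (f : {ffun G -> int}) : {ffun G -> int} * U :=
  ([ffun x => (f x %/ d)%Z], [ffun x => inord (absz (f (val x) %% d)%Z)]).
have mono (a b : int) : `|a - b| <= H%:Z ->
    (a %/ d)%Z <= (b %/ d)%Z + h%:Z.
  move=> ab; rewrite addrC -(divzMDl h%:Z b d0); apply: lez_pdiv2r => //.
  rewrite /d; lia.
apply: (@card_fset_set_le _ _ (Lip [set s]%SET H) F).
  move=> f [f0 Lf]; rewrite allpairs_f ?mem_enum //= in_fset_set // inE; split.
    by move=> x /f0; rewrite ffunE => ->; rewrite div0z.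
  move=> x y exy; rewrite !ffunE.
  have := mono _ _ (Lf _ _ exy); rewrite edge_sym in exy.
  by have := mono _ _ (Lf _ _ exy); lia.
move=> f g [f0 _] [g0 _] [/ffunP fg /ffunP fg']; apply/ffunP => x.
have [->|xs] := eqVneq x s; first by rewrite f0 ?g0 ?set11.
rewrite (divz_eq (f x) d) (divz_eq (g x) d).
have := fg x; rewrite !ffunE => ->; congr (_ + _).
have := fg' (exist _ x xs); rewrite !ffunE /= => /(congr1 val) /=.
have bd (a : int) : 0 <= (a %% d)%Z < d by rewrite modz_ge0 //= ltz_pmod.
have := bd (f x); have := bd (g x); rewrite /d.
by move=> ? ?; rewrite !inordK; lia.
Qed.

(** * Grids *)

(** Values off the root can be chosen freely in [[0, h]]. This keeps the normalized counts at least
    1. *)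
Lemma card_Lip_ge (G : sgraph) (s : G) h : connected_graph G ->
  (h.+1 ^ #|G|.-1 <= card_Lip [set s]%SET h)%N.
Proof.
move=> conG; have finL := finite_Lip s h conG (finset.set11 s).
pose U := {ffun {x | x != s} -> 'I_h.+1}.
pose F (g : U) : {ffun G -> int} :=
  [ffun x => if insub x is Some u then (g u : nat)%:Z else 0].
have -> : (h.+1 ^ #|G|.-1 = size [seq F g | g <- enum {: U}])%N.
  by rewrite size_map -cardE card_ffun card_ord card_sig (cardC1 s).
apply: size_le_card_fset_set => //.
  rewrite map_inj_uniq ?enum_uniq // => g g' /ffunP gg'; apply/ffunP => u.
  by have := gg' (val u); rewrite !ffunE valK => -[] /val_inj.
move=> _ /mapP[g _ ->]; split=> [x /finset.set1P ->|x y _].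
  by rewrite ffunE insubF // eqxx.
have bd z : 0 <= F g z <= h%:Z.
  by rewrite ffunE; case: insubP => [u _ _|_ //]; case: (g u) => i /=; lia.
by have := bd x; have := bd y; lia.
Qed.

Definition window (h : nat) (c : int) : seq int :=
  [seq c - h%:Z + i%:Z | i <- iota 0 (2 * h).+1].

Lemma size_window h c : size (window h c) = (2 * h).+1.
Proof. by rewrite size_map size_iota. Qed.

Lemma mem_window h c x : (x \in window h c) = (`|x - c| <= h%:Z).
Proof.
apply/mapP/idP => [[i]|xc]; first by rewrite mem_iota; lia.
by exists (absz (x - c + h%:Z)); rewrite ?mem_iota; lia.
Qed.

Lemma window_uniq h c : uniq (window h c).
Proof. by rewrite map_inj_uniq ?iota_uniq // => i j; lia. Qed.

(** A function is recovered from its two restrictions, the second recentred at [s2], and from its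
    jump across the joining edge, which takes at most [2 * h + 1] values. *)
Lemma card_Lip_glue (G G1 G2 : sgraph) (i1 : G1 -> G) (i2 : G2 -> G)
    (s1 t1 : G1) (s2 : G2) h :
  connected_graph G1 -> connected_graph G2 ->
  (forall x y, edge x y -> edge (i1 x) (i1 y)) ->
  (forall x y, edge x y -> edge (i2 x) (i2 y)) ->
  (forall x, (exists x1, x = i1 x1) \/ (exists x2, x = i2 x2)) ->
  edge (i1 t1) (i2 s2) ->
  (card_Lip [set i1 s1]%SET h <=
   card_Lip [set s1]%SET h * (card_Lip [set s2]%SET h * (2 * h).+1))%N.
Proof.
move=> con1 con2 e1 e2 cov e12.
have fin1 := finite_Lip s1 h con1 (finset.set11 s1).
have fin2 := finite_Lip s2 h con2 (finset.set11 s2).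
rewrite /card_Lip -(size_window h 0) -!(size_allpairs pair).
pose F (f : {ffun G -> int}) : {ffun G1 -> int} * ({ffun G2 -> int} * int) :=
  ([ffun x => f (i1 x)], ([ffun x => f (i2 x) - f (i2 s2)],
    f (i2 s2) - f (i1 t1))).
apply: (@card_fset_set_le _ _ (Lip [set i1 s1]%SET h) F).
  move=> f [f0 Lf]; rewrite !allpairs_f //= ?mem_window ?in_fset_set // ?inE.
  - split=> [x /finset.set1P ->|x y /e1 /Lf]; last by rewrite !ffunE.
    by rewrite ffunE f0 ?finset.set11.
  - split=> [x /finset.set1P ->|x y /e2 /Lf]; first by rewrite ffunE subrr.
    by rewrite !ffunE; congr (_ <= _); congr `|_|; ring.
  - by rewrite subr0 Lf // edge_sym.
move=> f g _ _ [/ffunP fg1 /ffunP fg2 fg]; apply/ffunP => x.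
have E1 z : f (i1 z) = g (i1 z) by have := fg1 z; rewrite !ffunE.
case: (cov x) => -[z ->//].
by have := fg2 z; have := fg; rewrite !ffunE E1 => /addIr -> /addIr ->.
Qed.

Lemma homo_connect (G H : sgraph) (f : G -> H) x y :
  (forall x y, edge x y -> edge (f x) (f y)) ->
  connect edge x y -> connect edge (f x) (f y).
Proof.
move=> fe /connectP[p pP ->]; apply/connectP; exists (map f p).
  by rewrite path_map; apply: sub_path pP.
by rewrite last_map.
Qed.

Lemma connected_path n : connected_graph (path_graph n).
Proof.
have up k (i j : 'I_n) : j = (i + k)%N :> nat ->
    connect (edge : rel (path_graph n)) i j.
  elim: k i => [|k IH] i ij.
    by have -> : i = j; [apply/val_inj; rewrite /= ij addn0|exact: connect0].
  have lt : (i.+1 < n)%N by have := ltn_ord j; lia.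
  apply: (@connect_trans _ _ (Ordinal lt)); last by apply: IH; rewrite /=; lia.
  by apply: connect1; rewrite /= /path_edge /= eqxx.
have sym := sym_connect_sym (@edge_sym (path_graph n)).
move=> i j; case: (leqP i j) => ij; last rewrite sym.
  by apply: (up (j - i)%N); lia.
by apply: (up (i - j)%N); lia.
Qed.

Lemma connected_cartesian_product (G H : sgraph) :
  connected_graph G -> connected_graph H ->
  connected_graph (cartesian_product G H).
Proof.
move=> conG conH [x1 x2] [y1 y2]; apply: (@connect_trans _ _ (y1, x2)).
  apply: (@homo_connect _ (cartesian_product G H)
    (fun z => (z, x2))) (conG _ _).
  by move=> x y xy; rewrite /= /box_edge /= eqxx xy orbT.
apply: (@homo_connect _ (cartesian_product G H) (fun z => (y1, z))) (conH _ _).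
by move=> x y xy; rewrite /= /box_edge /= eqxx xy.
Qed.

Lemma connected_grid m n : connected_graph (grid m n).
Proof.
exact: connected_cartesian_product (connected_path m) (connected_path n).
Qed.

Lemma card_grid m n : #|grid m n| = (m * n)%N.
Proof. by rewrite card_prod !card_ord. Qed.

(* Functions with value in [[-h, h]] at the root, up to the convention that the
   empty grid counts for [1]: this makes [lip_grid] submultiplicative. *)
Definition lip_grid (h m n : nat) : nat :=
  if m is m'.+1 then
    if n is n'.+1 then
      (card_Lip [set (ord0, ord0) : grid m'.+1 n'.+1]%SET h * (2 * h).+1)%N
    else 1%N
  else 1%N.

Lemma lip_grid0 h m : lip_grid h m 0 = 1%N. Proof. by case: m. Qed.

Lemma path_lshift m n (i j : 'I_m) :
  path_edge (lshift n i) (lshift n j) = path_edge i j.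
Proof. by []. Qed.

Lemma path_rshift m n (i j : 'I_n) :
  path_edge (rshift m i) (rshift m j) = path_edge i j.
Proof. by rewrite /path_edge /= -!addnS !eqn_add2l. Qed.

(** The blocks are glued along a single edge of the first column; its possible jumps supply the root
    factor of the second block. *)
Lemma lip_gridDl h m1 m2 n :
  (lip_grid h (m1 + m2) n <= lip_grid h m1 n * lip_grid h m2 n)%N.
Proof.
case: n => [|n]; first by rewrite !lip_grid0.
case: m1 => [|m1]; first by rewrite mul1n.
case: m2 => [|m2]; first by rewrite muln1 addn0.
rewrite /lip_grid /= mulnAC mulnA leq_mul2r /= -!mulnA.
pose i1 (x : grid m1.+1 n.+1) : grid (m1.+1 + m2.+1) n.+1 :=
  (lshift m2.+1 x.1, x.2).
pose i2 (x : grid m2.+1 n.+1) : grid (m1.+1 + m2.+1) n.+1 :=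
  (rshift m1.+1 x.1, x.2).
have -> : (ord0, ord0) = i1 (ord0, ord0).
  by congr (_, _); apply/val_inj.
apply: (@card_Lip_glue _ _ _ i1 i2 _ (ord_max, ord0) (ord0, ord0)).
- exact: connected_grid.
- exact: connected_grid.
- move=> [x1 x2] [y1 y2]; rewrite /= /box_edge /=.
  by rewrite path_lshift -(inj_eq (@lshift_inj m1.+1 m2.+1)).
- move=> [x1 x2] [y1 y2]; rewrite /= /box_edge /=.
  by rewrite path_rshift -(inj_eq (@rshift_inj m1.+1 m2.+1)).
- move=> [x1 x2]; case: (split_ordP x1) => y ->; [left|right];
  by exists (y, x2).
- by rewrite /= /box_edge /= /path_edge /= addn0 eqxx orbT.
Qed.

Lemma lip_gridDr h m n1 n2 :
  (lip_grid h m (n1 + n2) <= lip_grid h m n1 * lip_grid h m n2)%N.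
Proof.
case: m => [//|m].
case: n1 => [|n1]; first by rewrite mul1n.
case: n2 => [|n2]; first by rewrite muln1 addn0.
rewrite /lip_grid /= mulnAC mulnA leq_mul2r /= -!mulnA.
pose i1 (x : grid m.+1 n1.+1) : grid m.+1 (n1.+1 + n2.+1) :=
  (x.1, lshift n2.+1 x.2).
pose i2 (x : grid m.+1 n2.+1) : grid m.+1 (n1.+1 + n2.+1) :=
  (x.1, rshift n1.+1 x.2).
have -> : (ord0, ord0) = i1 (ord0, ord0).
  by congr (_, _); apply/val_inj.
apply: (@card_Lip_glue _ _ _ i1 i2 _ (ord0, ord_max) (ord0, ord0)).
- exact: connected_grid.
- exact: connected_grid.
- move=> [x1 x2] [y1 y2]; rewrite /= /box_edge /=.
  by rewrite path_lshift -(inj_eq (@lshift_inj n1.+1 n2.+1)).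
- move=> [x1 x2] [y1 y2]; rewrite /= /box_edge /=.
  by rewrite path_rshift -(inj_eq (@rshift_inj n1.+1 n2.+1)).
- move=> [x1 x2]; case: (split_ordP x2) => y ->; [left|right];
  by exists (x1, y).
- by rewrite /= /box_edge /= /path_edge /= addn0 eqxx.
Qed.

Lemma lip_grid11 h : (lip_grid h 1 1 <= (2 * h).+1)%N.
Proof.
rewrite /lip_grid -[leqRHS]mul1n leq_mul2r /=.
apply: (@card_fset_set_le _ _ _ id [:: [ffun _ : grid 1 1 => 0]]) => [|//].
move=> f [f0 _]; rewrite inE.
apply/eqP/ffunP => -[x y]; rewrite ffunE f0 // !ord1; exact: finset.set11.
Qed.

Lemma lip_gridMl h q m n : (lip_grid h (q * m) n <= lip_grid h m n ^ q)%N.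
Proof.
elim: q => [|q IH]; first by rewrite mul0n.
by rewrite mulSn expnS (leq_trans (lip_gridDl _ _ _ _)) // leq_mul2l IH orbT.
Qed.

Lemma lip_gridMr h q m n : (lip_grid h m (q * n) <= lip_grid h m n ^ q)%N.
Proof.
elim: q => [|q IH]; first by rewrite mul0n lip_grid0.
by rewrite mulSn expnS (leq_trans (lip_gridDr _ _ _ _)) // leq_mul2l IH orbT.
Qed.

Lemma leq_expn2r a b e : (a <= b -> a ^ e <= b ^ e)%N.
Proof. by case: e => // e ab; rewrite leq_exp2r. Qed.

Lemma lip_grid_le h m n : (lip_grid h m n <= (2 * h).+1 ^ (m * n))%N.
Proof.
have := lip_gridMl h m 1 n; rewrite muln1 => /leq_trans; apply.
have := lip_gridMr h n 1 1.
rewrite muln1 => /(leq_expn2r _ _ m) /leq_trans; apply.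
by rewrite -expnM mulnC; exact/leq_expn2r/lip_grid11.
Qed.

(** Writing [n = q * m + r], cut the square into [q ^ 2] squares of side [m] and leftover strips of
    total area [q * m * r + r * n], where each vertex costs a factor [2 * h + 1]. *)
Lemma lip_grid_square h n m (k := ((n %/ m) ^ 2)%N) :
  (lip_grid h n n <= lip_grid h m m ^ k * (2 * h).+1 ^ (n ^ 2 - k * m ^ 2))%N.
Proof.
rewrite /k; move: (n %/ m)%N (n %% m)%N (divn_eq n m) => q r nE {k}.
have -> : (n ^ 2 - q ^ 2 * m ^ 2 = (m * r) * q + r * n)%N.
  by rewrite nE; nia.
rewrite {1}nE; apply: leq_trans (lip_gridDl _ _ _ _) _.
rewrite expnD mulnA; apply: leq_mul; last exact: lip_grid_le.
apply: leq_trans (lip_gridMl _ _ _ _) _.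
rewrite expnM -mulnn expnM -expnMn; apply: leq_expn2r.
rewrite nE; apply: leq_trans (lip_gridDr _ _ _ _) _.
by apply: leq_mul; [exact: lip_gridMr|exact: lip_grid_le].
Qed.

(** * Rearrangement *)

Lemma sum_nat_of_bool (T : Type) (s : seq T) (P : pred T) :
  (\sum_(x <- s) P x = count P s)%N.
Proof.
by rewrite -sum1_count [RHS]big_mkcond; apply: eq_bigr => x _; case: (P x).
Qed.

Definition near_int (h : nat) : rel int := fun x y => `|x - y| <= h%:Z.

Definition close_pairs (h : nat) (s1 s2 : seq int) : nat :=
  (\sum_(x <- s1) \sum_(y <- s2) near_int h x y)%N.

Lemma close_pairs_perm h s1 s2 t1 t2 : perm_eq s1 t1 -> perm_eq s2 t2 ->
  close_pairs h s1 s2 = close_pairs h t1 t2.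
Proof.
move=> p1 p2; rewrite /close_pairs (perm_big _ p1) /=.
by apply: eq_bigr => x _; rewrite (perm_big _ p2).
Qed.

Lemma close_pairs_le h s1 s2 : (close_pairs h s1 s2 <= size s1 * size s2)%N.
Proof.
elim: s1 => [|x s1 IH]; first by rewrite /close_pairs big_nil.
by rewrite /close_pairs big_cons sum_nat_of_bool leq_add // count_size.
Qed.

(* The differences [x - z], [x - y], [z - y] on the hook through the two minima
   [x] and [y] are pairwise distinct. *)
Lemma close_pairs_cons h x y s1 s2 :
  sorted <%R (x :: s1) -> sorted <%R (y :: s2) ->
  (close_pairs h (x :: s1) (y :: s2) <= (2 * h).+1 + close_pairs h s1 s2)%N.
Proof.
move=> /= xs1 ys2.
have /allP xlt := order_path_min lt_trans xs1.
have /allP ylt := order_path_min lt_trans ys2.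
have /lt_sorted_uniq u1 := path_sorted xs1.
have /lt_sorted_uniq u2 := path_sorted ys2.
pose P (z : int) := `|z| <= h%:Z.
pose L := [seq x - z | z <- s2] ++ x - y :: [seq z - y | z <- s1].
have uL : uniq L.
  rewrite cat_uniq /= !map_inj_uniq //; try by move=> ? ?; lia.
  rewrite u1 u2 /= negb_or -!andbA; apply/and4P; split=> //.
  - by apply/mapP => -[z /ylt]; lia.
  - by apply/hasPn => _ /mapP[z /xlt xz ->]; apply/mapP => -[z' /ylt]; lia.
  - by apply/mapP => -[z /xlt]; lia.
have -> : close_pairs h (x :: s1) (y :: s2) =
    (count P L + close_pairs h s1 s2)%N.
  rewrite /close_pairs !big_cons sum_nat_of_bool.
  under [X in (_ + X)%N]eq_bigr do rewrite big_cons.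
  rewrite big_split /= sum_nat_of_bool count_cat /= !count_map !addnA.
  by congr (_ + _ + _)%N; rewrite addnC.
rewrite leq_add2r -size_filter -(size_window h 0).
apply: uniq_leq_size; first exact: filter_uniq.
by move=> z; rewrite mem_filter mem_window subr0 => /andP[].
Qed.

(** Discrete Riesz inequality, by peeling off both minima. With total size [2 * h + 1 + i] and
    [i >= 2], this lowers [4 * (size s1 * size s2)] by [4 * (2 * h + i)] and [i * i.-1] by
    [4 * i - 6], while the hook contributes at most [4 * (2 * h + 1)]. For [i <= 1] the trivial
    bound suffices. *)
Lemma close_pairs_bound_sorted h s1 s2
    (i := (size s1 + size s2 - (2 * h).+1)%N) :
  sorted <%R s1 -> sorted <%R s2 ->
  (size s1 <= (2 * h).+1)%N -> (size s2 <= (2 * h).+1)%N ->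
  (4 * close_pairs h s1 s2 + i * i.-1 <= 4 * (size s1 * size s2))%N.
Proof.
rewrite {}/i; elim: s1 s2 => [|x s1 IH] s2 xs1 ys2 m1 m2.
  by have := close_pairs_le h [::] s2; rewrite /= in m2 *; nia.
have := close_pairs_le h (x :: s1) s2.
case: s2 ys2 m2 => [|y s2] ys2 m2; first by rewrite /= in m1 *; nia.
have /= := IH s2 (path_sorted xs1) (path_sorted ys2) (ltnW m1) (ltnW m2).
have := close_pairs_cons h x y s1 s2 xs1 ys2.
rewrite !addSn !addnS.
move: (close_pairs _ _ _) (close_pairs _ _ _) => P Q.
have [|] := leqP (2 * h).+1 (size s1 + size s2); nia.
Qed.

Lemma close_pairs_bound h s1 s2 (i := (size s1 + size s2 - (2 * h).+1)%N) :
  uniq s1 -> uniq s2 ->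
  (size s1 <= (2 * h).+1)%N -> (size s2 <= (2 * h).+1)%N ->
  (4 * close_pairs h s1 s2 + i * i.-1 <= 4 * (size s1 * size s2))%N.
Proof.
move=> u1 u2; rewrite {}/i.
have p1 : perm_eq s1 (sort <=%R s1) by rewrite perm_sym perm_sort.
have p2 : perm_eq s2 (sort <=%R s2) by rewrite perm_sym perm_sort.
rewrite (close_pairs_perm h _ _ _ _ p1 p2) (perm_size p1) (perm_size p2).
by apply: close_pairs_bound_sorted; rewrite sort_lt_sorted.
Qed.

(** Summation by parts: nonincreasing nonnegative weights preserve domination of partial sums. *)
Lemma ler_sum_abel (R : realFieldType) (N : nat) (u x y : nat -> R) :
  (forall j, (j.+1 < N)%N -> u j.+1 <= u j) ->
  (forall j, (j < N)%N -> 0 <= u j) ->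
  (forall k, (k <= N)%N -> \sum_(j < k) x j <= \sum_(j < k) y j) ->
  \sum_(j < N) u j * x j <= \sum_(j < N) u j * y j.
Proof.
case: N => [|N]; first by rewrite !big_ord0.
move=> ud u0 xy.
(* The boundary term of the summation by parts is kept on the left so that the induction closes; at
   [k = N] it is nonnegative. *)
suff main k : (k <= N)%N -> u k * (\sum_(j < k.+1) y j - \sum_(j < k.+1) x j) <=
    \sum_(j < k.+1) u j * y j - \sum_(j < k.+1) u j * x j.
  rewrite -subr_ge0 (le_trans _ (main N _)) // mulr_ge0 ?u0 //.
  by rewrite subr_ge0 xy.
elim: k => [_|k IH kN].
  by rewrite !big_ord_recr !big_ord0 /= !add0r mulrBr.
have := IH (ltnW kN); rewrite 4!(big_ord_recr k.+1) /=.
have := ud k kN; have := xy k.+1 (ltnW kN).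
by move: (\sum_(j < k.+1) y j) (\sum_(j < k.+1) x j) => Y X; nra.
Qed.

(* Order the points of [[-h, h]] by increasing modulus. The kernel
   [|x - y| <= h] then equals [1] for [s + t < 2 * h + 1] and alternates between
   [0] and [1] beyond; the alternating part is replaced by its average. *)
Definition rearr_kernel (R : realFieldType) (N s t : nat) : R :=
  if (s + t < N)%N then 1 else 2^-1.

Arguments rearr_kernel R N s t : clear implicits.

(** With [i = m + r - N], exactly [i * (i - 1) / 2] pairs have [s + t >= N], each losing [1 / 2].
    The result is the right-hand side of the Riesz bound. *)
Lemma sum_rearr_kernel (R : realFieldType) (N m r : nat) :
  (m <= N)%N -> (r <= N)%N ->
  4 * (\sum_(s < m) \sum_(t < r) rearr_kernel R N s t) =
  4 * (m%:R * r%:R) - ((m + r - N) * (m + r - N).-1)%:R.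
Proof.
have row s : (s <= N)%N -> (r <= N)%N ->
    2 * (\sum_(t < r) rearr_kernel R N s t) = 2 * r%:R - (s + r - N)%:R.
  move=> sN; elim: r => [|r IH] rN.
    by rewrite big_ord0 !mulr0 (_ : s + 0 - N = 0)%N ?subr0 //; lia.
  rewrite big_ord_recr /= mulrDr IH ?(ltnW rN) // /rearr_kernel.
  have [sr|sr] := ltnP (s + r) N.
    have -> : (s + r - N = 0)%N by lia.
    have -> : (s + r.+1 - N = 0)%N by lia.
    by rewrite -natr1; ring.
  rewrite addnS subSn // -natr1 -[in RHS]natr1.
  by move: (_ - _)%N => d; field.
move=> mN rN; elim: m mN => [|m IH] mN.
  by rewrite big_ord0 mulr0 (_ : 0 + r - N = 0)%N ?mul0r ?mulr0 ?subr0 //; lia.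
rewrite big_ord_recr /= mulrDr IH ?(ltnW mN) //.
set T := \sum_(t < r) _.
have -> : 4 * T = 2 * (2 * r%:R - (m + r - N)%:R).
  by rewrite -(row m (ltnW mN) rN) -/T; ring.
rewrite -natr1 addSn; have [mr|mr] := ltnP (m + r) N.
  have -> : (m + r - N = 0)%N by lia.
  have -> : ((m + r).+1 - N = 0)%N by lia.
  by ring.
rewrite subSn //; move: (m + r - N)%N => j.
by case: j => [|j]; rewrite /= ?natrM -?natr1; ring.
Qed.

Lemma close_pairs_kernel (R : realFieldType) h l1 l2 :
  uniq l1 -> uniq l2 ->
  (size l1 <= (2 * h).+1)%N -> (size l2 <= (2 * h).+1)%N ->
  (close_pairs h l1 l2)%:R <=
    \sum_(s < size l1) \sum_(t < size l2) rearr_kernel R (2 * h).+1 s t.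
Proof.
move=> u1 u2 m1 m2; rewrite -(ler_pM2l (_ : 0 < 4 :> R)) //.
rewrite sum_rearr_kernel // lerBrDr -!natrM -natrD ler_nat.
exact: close_pairs_bound.
Qed.

(* A row step of the transfer operator preserves the domination of [g] by a
   rearranged multiple of a supersolution [w] of the centred operator. *)
Lemma transfer_step (R : realFieldType) (h : nat) (c : int) (w : nat -> R)
    (L C : R) (g : int -> R) :
  let N := (2 * h).+1 in
  0 <= C ->
  (forall t, (t.+1 < N)%N -> w t.+1 <= w t) ->
  (forall t, (t < N)%N -> 0 <= w t) ->
  (forall s, (s < N)%N ->
    \sum_(t < N) w t * rearr_kernel R N s t <= L * w s) ->
  (forall l : seq int, uniq l -> {subset l <= window h c} ->
    \sum_(y <- l) g y <= C * \sum_(t < size l) w t) ->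
  forall l : seq int, uniq l -> (size l <= N)%N ->
    \sum_(x <- l) \sum_(y <- window h c | near_int h y x) g y <=
    C * L * \sum_(t < size l) w t.
Proof.
move=> N C0 wd w0 wL gW l ul lN.
pose psi y := (\sum_(x <- l) near_int h x y)%N.
(* List the window by decreasing number [psi] of neighbours in [l], so that [psi] can serve as a
   weight in Abel summation. *)
pose s := sort (relpre psi geq) (window h c).
have ps : perm_eq s (window h c) by rewrite perm_sort.
have sN : size s = N by rewrite (perm_size ps) size_window.
have us : uniq s by rewrite (perm_uniq ps) window_uniq.
have sumE (F : int -> R) k : (k <= N)%N ->
    \sum_(y <- take k s) F y = \sum_(j < k) F (nth 0 s j).
  move=> kN; rewrite (big_nth 0) size_takel ?sN // big_mkord.
  by apply: eq_bigr => j _; rewrite nth_take.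
have -> : \sum_(x <- l) \sum_(y <- window h c | near_int h y x) g y =
    \sum_(j < N) (psi (nth 0 s j))%:R * g (nth 0 s j).
  rewrite -(sumE (fun y => (psi y)%:R * g y)) // take_oversize ?sN //.
  rewrite (perm_big _ ps) /=.
  under eq_bigr do rewrite big_mkcond; rewrite exchange_big /=.
  apply: eq_bigr => y _; rewrite natr_sum mulr_suml; apply: eq_bigr => x _.
  by rewrite /near_int distrC; case: ifP; rewrite ?mul1r ?mul0r.
have psid j : (j.+1 < N)%N -> (psi (nth 0%R s j.+1) <= psi (nth 0%R s j))%N.
  have srt : sorted (relpre psi geq) s.
    by apply: sort_sorted => x y; exact: leq_total.
  by rewrite -sN; move/(sortedP 0): srt; apply.
(* First Abel summation, with weight [psi]: the hypothesis on [g], applied to initial segments of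
   [s], replaces [g] by [C * w]. *)
apply: le_trans (_ : \sum_(j < N) (psi (nth 0 s j))%:R * (C * w j) <= _).
  apply: (@ler_sum_abel _ _ (fun j => (psi s`_j)%:R)
    (fun j => g s`_j) (fun j => C * w j)).
  - by move=> j jN; rewrite ler_nat psid.
  - by move=> *; exact: ler0n.
  move=> k kN; rewrite -sumE // -mulr_sumr.
  have := gW (take k s); rewrite size_takel ?sN //; apply.
    exact: take_uniq.
  by move=> y /mem_take; rewrite (perm_mem ps).
under eq_bigr do rewrite mulrCA (mulrC _%:R).
rewrite -mulr_sumr -mulrA ler_wpM2l //.
(* Second Abel summation, now with weight [w]: the Riesz bound for [l] and initial segments of [s]
   replaces [psi] by column sums of the kernel. *)
apply: le_trans
  (_ : \sum_(j < N) w j * \sum_(i < size l) rearr_kernel R N i j <= _).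
  apply: (@ler_sum_abel _ _ w (fun j => (psi s`_j)%:R)
    (fun j => \sum_(i < size l) rearr_kernel R N i j)) => // k kN.
  rewrite exchange_big /=.
  have := close_pairs_kernel R h l (take k s) ul (take_uniq _ us) lN.
  rewrite size_takel ?sN // => /(_ kN); apply: le_trans.
  rewrite /close_pairs exchange_big /= natr_sum sumE //.
under eq_bigr do rewrite mulr_sumr.
rewrite exchange_big /= mulr_sumr; apply: ler_sum => i _.
by apply: wL; exact: leq_trans lN.
Qed.

(** * The eigenfunction *)

Section Weight.
Variable R : realType.
Let om : R := atan (3 / 4).
Let f (x : R) : R := cos x - sin x / 2.
(** An antiderivative of [f]. The identity [F (om - y) = f y], which forces [cos om = 4 / 5] and
    [sin om = 3 / 5], is the eigenfunction equation. *)
Let F (x : R) : R := sin x + cos x / 2.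

Lemma cos_atan34 : cos om = 4 / 5.
Proof.
rewrite /om cos_atan (_ : 1 + _ = (5 / 4) ^+ 2); last by field.
by rewrite sqrtr_sqr ger0_norm; [field|lra].
Qed.

Lemma sin_atan34 : sin om = 3 / 5.
Proof.
have := @atanK R (3 / 4).
rewrite -/om /tan cos_atan34 => /(congr1 ( *%R^~ (4 / 5))).
by rewrite divfK; [move=> ->; field|rewrite lt0r_neq0 //; lra].
Qed.

Lemma atan34_gt0 : 0 < om.
Proof.
rewrite ltNge; apply/negP => om0.
have := sin_atan34; have := @sin_ge0_pi R (- om).
have := atan_gtNpi2 (3 / 4 : R); rewrite -/om => h.
have := pi_gt0 R; rewrite sinN => p0 s.
by have := s ltac:(apply/andP; split; lra); lra.
Qed.

Lemma atan34_lt_pihalf : om < pi / 2. Proof. exact: atan_ltpi2. Qed.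

Let f_dec (x y : R) : 0 <= x -> x <= y -> y <= om -> f y <= f x.
Proof.
move=> x0 xy yom; have := atan34_lt_pihalf; have := pi_gt0 R => p0 omp.
rewrite /f lerB //.
  by rewrite leNgt ltr_cos -?leNgt // in_itv /=; apply/andP; split; lra.
rewrite ler_pM2r ?invr_gt0 //.
by rewrite leNgt ltr_sin -?leNgt // in_itv /=; apply/andP; split; lra.
Qed.

(** By the mean value theorem and monotonicity of [f]: right-endpoint Riemann sums of [f] stay below
    the increments of [F]. *)
Let F_incr (x y : R) : 0 <= x -> x <= y -> y <= om ->
  f y * (y - x) <= F y - F x.
Proof.
move=> x0 xy yom.
have dF (z : R) : is_derive z (1 : R) F (f z).
  rewrite (_ : F = sin + 2^-1 *: cos); last first.
    by apply/funext => t; rewrite /F !fctE /= mulrC.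
  apply: is_derive_eq.
  by rewrite /f scalerN mulrC.
have [|c] := @MVT_segment R F f x y xy (fun z _ => dF z).
  by apply: derivable_within_continuous => z _; case: (dF z).
rewrite in_itv /= => /andP[xc cy] ->; rewrite ler_wpM2r ?subr_ge0 //.
by apply: f_dec => //; lra.
Qed.

(* [f] is a multiple of the Perron eigenfunction of the kernel [|x - y| <= 1] on
   [[-1, 1]] (as a function of [omega |x|]); its eigenvalue is [1 / omega]. *)
Lemma supersolution_exists (N : nat) : (0 < N)%N -> exists w : nat -> R,
  [/\ forall t, (t.+1 < N)%N -> w t.+1 <= w t,
      forall t, (t < N)%N -> 2^-1 <= w t <= 1 &
      forall s, (s < N)%N -> \sum_(t < N) w t * rearr_kernel R N s t <=
        (N%:R / 2 / om + 1) * w s].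
Proof.
move=> N0; have om0 := atan34_gt0; have NR : 0 < N%:R :> R by rewrite ltr0n.
pose d := om / N%:R; have d0 : 0 < d by rewrite divr_gt0.
have dN : N%:R * d = om by rewrite mulrC divfK ?gt_eqF.
have le_om t : (t <= N)%N -> t%:R * d <= om.
  by move=> tN; rewrite -dN ler_pM2r // ler_nat.
have ge0 t : 0 <= t%:R * d by rewrite mulr_ge0 // ltW.
pose w t := f (t%:R * d); exists w.
have f0 : f 0 = 1 by rewrite /f cos0 sin0 mul0r subr0.
have fom : f om = 2^-1 by rewrite /f cos_atan34 sin_atan34; field.
have Fom : F om = 1 by rewrite /F cos_atan34 sin_atan34; field.
have wge t : (t <= N)%N -> 2^-1 <= w t.
  by move=> tN; rewrite -fom; apply: f_dec; rewrite ?le_om ?ge0 ?lexx.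
(* Passing from the left-endpoint to the right-endpoint Riemann sum costs [d * (w 0 - w k)], with
   [w 0 = 1]; the constant [2^-1] is [F 0]. *)
have W k : (k <= N)%N ->
    d * \sum_(t < k) w t <= d * (1 - w k) + F (k%:R * d) - 2^-1.
  elim: k => [|k IH] kN.
    rewrite big_ord0 /w mul0r f0 /F sin0 cos0; lra.
  rewrite big_ord_recr /= mulrDr; have := IH (ltnW kN).
  have kk : k%:R * d <= k.+1%:R * d by rewrite ler_pM2r // ler_nat.
  have := F_incr _ _ (ge0 k) kk (le_om _ kN).
  rewrite (_ : k.+1%:R * d - k%:R * d = d); last by rewrite -natr1; ring.
  rewrite -/(w k.+1); lra.
split.
- move=> t tN; apply: (f_dec _ _ (ge0 t) _ (le_om _ (ltnW tN))).
  by rewrite ler_pM2r // ler_nat.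
- move=> t tN; rewrite wge ?(ltnW tN) //= -f0.
  by apply: f_dec; rewrite ?le_om ?ge0 // ltnW.
move=> s sN; set X := (X in X <= _).
(* The kernel is one half everywhere plus another half on [t < N - s]. *)
have XE : X = (\sum_(t < N) w t + \sum_(t < N - s) w t) / 2.
  have -> : X = \sum_(t < N) w t / 2 + \sum_(t < N | (t < N - s)%N) w t / 2.
    rewrite [X in _ + X]big_mkcond -big_split; apply: eq_bigr => t _ /=.
    by rewrite /rearr_kernel ltn_subRL; case: ifP => _; field.
  rewrite -!mulr_suml mulrDl; congr (_ + _ / _).
  by rewrite (big_ord_widen N w (leq_subr s N)).
have := W N (leqnn N); have := W (N - s)%N (leq_subr _ _).
rewrite dN Fom natrB ?(ltnW sN) // mulrBl dN.
have -> : F (om - s%:R * d) = w s.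
  by rewrite /F /w /f sinB cosB cos_atan34 sin_atan34; field.
have := wge N (leqnn _); have := wge (N - s)%N (leq_subr _ _).
have := wge s (ltnW sN) => ws ws' wN WNs WN.
(* Both values [w N] and [w (N - s)] are at least [1 / 2], so the total discretisation error is at
   most [d / 2]. As [w s >= 1 / 2], the [+ 1] in the eigenvalue absorbs it. *)
have dX : d * X <= (d + w s) / 2 by rewrite XE; nra.
rewrite -(ler_pM2l d0) (le_trans dX) //.
have -> : N%:R / 2 / om = (2 * d)^-1.
  by rewrite /d; field; rewrite !gt_eqF.
rewrite (_ : d * _ = w s / 2 + d * w s); last by field; rewrite gt_eqF.
nra.
Qed.
End Weight.

(** * Counting the next row *)

(** The size, as a function of the left neighbour [x], is a product of transfer operators, one per
    entry of [a], applied to the constant 1. *)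
Fixpoint next_rows_from (h : nat) (a : seq int) (x : int) : seq (seq int) :=
  if a is c :: a' then
    [seq y :: b | y <- [seq y <- window h c | near_int h y x],
                  b <- next_rows_from h a' y]
  else [:: [::]].

Definition next_rows (h : nat) (a : seq int) : seq (seq int) :=
  if a is c :: a' then
    [seq y :: b | y <- window h c, b <- next_rows_from h a' y]
  else [:: [::]].

Lemma mem_next_rows (I : eqType) h (p q : I -> int) (s : seq I) :
  (forall i, i \in s -> near_int h (p i) (q i)) ->
  sorted (fun i j => near_int h (p j) (p i)) s ->
  [seq p i | i <- s] \in next_rows h [seq q i | i <- s].
Proof.
move=> pq; have from i s' : {subset s' <= s} ->
    path (fun i j => near_int h (p j) (p i)) i s' ->
    [seq p i | i <- s'] \in next_rows_from h [seq q i | i <- s'] (p i).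
  elim: s' i => [//|j s' IH] i ss /andP[ji js].
  apply/allpairsPdep; exists (p j), [seq p i | i <- s']; split=> //.
    by rewrite mem_filter ji mem_window [_ <= _]pq // ss ?mem_head.
  by apply: IH => // k ks; rewrite ss // inE ks orbT.
case: s pq from => [//|i s] pq from is_.
apply/allpairsPdep; exists (p i), [seq p i | i <- s]; split=> //.
  by rewrite mem_window [_ <= _]pq ?mem_head.
by apply: from => // k ks; rewrite inE ks orbT.
Qed.

(** Iterates [transfer_step], each entry of [a] costing a factor [L]; finally [w <= 1] bounds the
    sum of [w] over the first window. *)
Lemma size_next_rows (R : realType) (h : nat) (a : seq int) c
    (L := (2 * h).+1%:R / 2 / atan (3 / 4) + 1 : R) :
  (size (next_rows h (c :: a)))%:R <= 2 * (2 * h).+1%:R * L ^+ size a.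
Proof.
have [w [wd wb wL]] := supersolution_exists R _ (ltn0Sn (2 * h)).
have wge t : (t < (2 * h).+1)%N -> 2^-1 <= w t by move=> /wb /andP[].
have wle t : (t < (2 * h).+1)%N -> w t <= 1 by move=> /wb /andP[].
have L0 : 0 <= L.
  rewrite /L addr_ge0 // divr_ge0 // ?divr_ge0 //.
  exact/ltW/(atan34_gt0 R).
(* The claim covers all sublists of a window, as [transfer_step] requires. The factor 2 starts the
   induction: [1 <= 2 * w t]. *)
have main c' l : uniq l -> {subset l <= window h c'} ->
    \sum_(y <- l) (size (next_rows_from h a y))%:R <=
    2 * L ^+ size a * \sum_(t < size l) w t.
  elim: a c' l => [|c'' a IH] c' l ul lc.
    rewrite expr0 mulr1 /= big_const_seq count_predT iter_addr_0.
    rewrite -[size l in leLHS]card_ord -sumr_const mulr_sumr.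
    apply: ler_sum => t _; have lN := uniq_leq_size ul lc.
    rewrite size_window in lN.
    by have := wge t (leq_trans (ltn_ord t) lN); lra.
  have lN := uniq_leq_size ul lc; rewrite size_window in lN.
  have w0 t : (t < (2 * h).+1)%N -> 0 <= w t by move=> /wge; lra.
  have C0 : 0 <= 2 * L ^+ size a by rewrite mulr_ge0 ?exprn_ge0.
  have := transfer_step R h c'' w L (2 * L ^+ size a)
    (fun y => (size (next_rows_from h a y))%:R) C0 wd w0 wL (IH c'') l ul lN.
  rewrite [size (c'' :: a)]/= exprSr mulrA; apply: le_trans.
  rewrite le_eqVlt; apply/orP; left.
  apply/eqP; apply: eq_bigr => x _.
  rewrite size_allpairs_dep sumnE big_map natr_sum big_filter.
  by [].
have := main c _ (window_uniq h c) (fun _ => id).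
rewrite size_window size_allpairs_dep sumnE big_map natr_sum.
move=> /le_trans; apply.
rewrite mulrAC ler_wpM2r ?exprn_ge0 // ler_pM2l //.
rewrite -[(2 * h).+1 in leRHS]card_ord -sumr_const.
by apply: ler_sum => t _; apply: wle.
Qed.

Lemma path_edge_lift_max n (i j : 'I_n) :
  path_edge (lift ord_max i) (lift ord_max j) = path_edge i j.
Proof. by rewrite /path_edge !lift_max. Qed.

Lemma sorted_enum_ord n :
  sorted (fun i j : 'I_n => i.+1 == j :> nat) (enum 'I_n).
Proof.
have : sorted (fun i j => i.+1 == j) (map val (enum 'I_n)).
  rewrite val_enum_ord; case: n => //= n; elim: n 0%N => //= n IH k.
  by rewrite eqxx IH.
by rewrite sorted_map.
Qed.

(** A function is encoded by its restriction to all rows but the last and by the index of its last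
    row among those compatible with the preceding one. *)
Lemma card_Lip_next_row (h m n K : nat) :
  (forall a, size a = n.+1 -> (size (next_rows h a) <= K)%N) ->
  (card_Lip [set (ord0, ord0) : grid m.+2 n.+1]%SET h <=
   card_Lip [set (ord0, ord0) : grid m.+1 n.+1]%SET h * K)%N.
Proof.
move=> rowK.
have fin := @finite_Lip (grid m.+1 n.+1) _ (ord0, ord0) h (connected_grid _ _)
  (finset.set11 _).
rewrite /card_Lip -[X in (_ * X)%N](size_iota 0) -(size_allpairs pair).
pose up (x : grid m.+1 n.+1) : grid m.+2 n.+1 := (lift ord_max x.1, x.2).
pose row (f : {ffun grid m.+2 n.+1 -> int}) : seq int :=
  [seq f (ord_max, j) | j <- enum 'I_n.+1].
pose prev (f : {ffun grid m.+2 n.+1 -> int}) : seq int :=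
  [seq f (up (ord_max, j)) | j <- enum 'I_n.+1].
pose F (f : {ffun grid m.+2 n.+1 -> int}) :
    {ffun grid m.+1 n.+1 -> int} * nat :=
  ([ffun x => f (up x)], index (row f) (next_rows h (prev f))).
pose A := Lip [set (ord0, ord0) : grid m.+2 n.+1]%SET h.
have rowP f : A f -> row f \in next_rows h (prev f).
  move=> [_ Lf]; apply: mem_next_rows => [j _|].
    apply: Lf; rewrite /= /box_edge /= eqxx /path_edge lift_max.
    by rewrite /= eqxx !orbT.
  apply: sub_sorted (sorted_enum_ord n.+1) => i j /= ij; apply: Lf.
  by rewrite /= /box_edge /= eqxx /path_edge /= ij orbT.
apply: (@card_fset_set_le _ _ A F).
  move=> f Lf; rewrite allpairs_f ?mem_iota //=; last first.
    rewrite add0n; apply: leq_trans (rowK (prev f) _).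
      by rewrite index_mem rowP.
    by rewrite size_map size_enum_ord.
  rewrite in_fset_set // inE; split=> [x /finset.set1P ->|[x1 x2] [y1 y2]].
    rewrite ffunE Lf.1 //; apply/finset.set1P; congr (_, _); exact/val_inj.
  move=> e; rewrite !ffunE; apply: Lf.2; move: e.
  by rewrite /= /box_edge /= path_edge_lift_max (inj_eq lift_inj).
move=> f g Lf Lg [/ffunP fg].
have upE x : f (up x) = g (up x) by have := fg x; rewrite !ffunE.
have prevE : prev f = prev g by apply: eq_map => j; exact: upE.
move=> fg'.
have rowE : row f = row g.
  have := nth_index [::] (rowP f Lf); rewrite fg' prevE => <-.
  by rewrite nth_index // rowP.
apply/ffunP => -[x1 x2]; case: (unliftP ord_max x1) => [y|] ->.
  exact: (upE (y, x2)).
have /eq_in_map := rowE; apply; exact: mem_enum.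
Qed.

(** * Limits *)

(** The first row has at most [(2 * h + 1) ^ (n + 1)] choices, and each of the [m] further rows
    multiplies the count by at most [B]. *)
Lemma lip_grid_rows (R : realType) (h m n : nat)
    (L := (2 * h).+1%:R / 2 / atan (3 / 4) + 1 : R) :
  (lip_grid h m.+1 n.+1)%:R <=
  (2 * h).+1%:R ^+ n.+1 * (2 * (2 * h).+1%:R * L ^+ n) ^+ m.
Proof.
have L0 : 0 <= L.
  rewrite /L addr_ge0 // divr_ge0 // ?divr_ge0 //.
  exact/ltW/(atan34_gt0 R).
set B := 2 * _ * _; have B0 : 0 <= B by rewrite !mulr_ge0 // exprn_ge0.
have rowK a : size a = n.+1 -> (size (next_rows h a) <= Num.truncn B)%N.
  case: a => // c a [an]; rewrite truncn_ge_nat //.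
  by have := size_next_rows R h a c; rewrite an.
elim: m => [|m IH].
  by rewrite expr0 mulr1 -natrX ler_nat -[X in (_ ^ X)%N]mul1n lip_grid_le.
apply: (@le_trans _ _ ((lip_grid h m.+1 n.+1)%:R * B)); last first.
  by rewrite [B ^+ _]exprSr mulrA ler_wpM2r.
apply: (@le_trans _ _ ((lip_grid h m.+1 n.+1)%:R * (Num.truncn B)%:R)).
  rewrite -natrM ler_nat /lip_grid mulnAC leq_mul2r /=.
  exact: card_Lip_next_row.
by rewrite ler_wpM2l // -truncn_ge_nat.
Qed.

(** The limit is the infimum over [n >= N]: fix [m] with [u m] close to it, then let [n] grow so
    that the error term vanishes. *)
Lemma cvgn_almost_decreasing (R : realType) (N : nat) (C : R) (u : R^nat) :
  (0 < N)%N ->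
  (forall n, (N <= n)%N -> 0 <= u n) ->
  (forall m n, (N <= m)%N -> (N <= n)%N -> u n <= u m + C * (m%:R / n%:R)) ->
  cvgn u.
Proof.
move=> N0 u0 uC; pose E := [set u n | n in [set n | (N <= n)%N]].
have infE : has_inf E.
  split; first by exists (u N); exists N => //=.
  by exists 0 => _ [n Nn <-]; exact: u0.
have lb n : (N <= n)%N -> inf E <= u n.
  by move=> Nn; apply: ge_inf; [exact: infE.2|exists n].
apply/cvg_ex; exists (inf E); apply/cvgrPdist_lt => e e0.
have e2 : 0 < e / 2 by rewrite divr_gt0.
have [_ [m Nm <-] mE] := inf_adherent e2 infE.
have Kge : 0 <= `|C| * m%:R / (e / 2).
  by rewrite divr_ge0 // ?mulr_ge0 // ltW.
near=> n.
have Nn : (N <= n)%N by near: n; exact: nbhs_infty_ge.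
have n0 : 0 < n%:R :> R by rewrite ltr0n (leq_trans N0).
have Kn : `|C| * m%:R / (e / 2) < n%:R.
  by near: n; exact: nbhs_infty_gtr.
rewrite distrC ger0_norm ?subr_ge0 ?lb //.
have := uC m n Nm Nn; have : C * (m%:R / n%:R) < e / 2.
  rewrite mulrA ltr_pdivrMr // -ltr_pdivrMl // mulrC.
  apply: le_lt_trans Kn; rewrite ler_pM2r ?invr_gt0 //.
  by rewrite ler_wpM2r // ler_norm.
lra.
Unshelve. all: by end_near. Qed.

(** * The limit in [h] for a fixed connected graph *)

Section GraphLimit.
Variables (R : realType) (G : sgraph).
Hypothesis conG : connected_graph G.
Variables (S : {set G}) (hS : one_per_component G S) (t : G).
Let d := #|G|.-1.
Hypothesis d0 : (0 < d)%N.

Let a h : R := (card_Lip [set t]%SET h)%:R.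
Let u (h : nat) : R := h%:R^-1 * a h `^ d%:R^-1.

Let uX h : u h ^+ d = a h / h%:R ^+ d.
Proof.
rewrite /u exprMn exprVn mulrC -powR_mulrn ?powR_ge0 // -powRrM.
by rewrite mulVf ?powRr1 // pnatr_eq0 -lt0n.
Qed.

Let u_ge0 h : 0 <= u h.
Proof. by rewrite mulr_ge0 // powR_ge0. Qed.

Let u_ge1 h : (0 < h)%N -> 1 <= u h.
Proof.
move=> h0; have uh : u h \is Num.nneg by exact: u_ge0.
rewrite -(ler_pXn2r d0) ?nnegrE //.
rewrite uX expr1n ler_pdivlMr ?exprn_gt0 ?ltr0n // mul1r -natrX ler_nat.
apply: leq_trans (card_Lip_ge _ t h conG).
by rewrite leq_exp2r.
Qed.

Let u_scale h H k : (0 < h)%N -> (0 < H)%N -> (0 < k)%N -> (H <= k * h)%N ->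
  u H <= (k * h)%:R / H%:R * u h.
Proof.
move=> h0 H0 k0 Hk; have uH : u H \is Num.nneg by exact: u_ge0.
have ku : (k * h)%:R / H%:R * u h \is Num.nneg.
  by apply: mulr_ge0 (u_ge0 h); rewrite divr_ge0.
rewrite -(ler_pXn2r d0) // uX exprMn uX expr_div_n natrM exprMn.
rewrite ler_pdivrMr ?exprn_gt0 ?ltr0n //.
rewrite [leRHS](_ : _ = a h * k%:R ^+ d).
  by rewrite /a -natrX -natrM ler_nat card_Lip_scale.
by field; rewrite !expf_neq0 // pnatr_eq0 -lt0n.
Qed.

Let cvg_u : cvgn u.
Proof.
apply: (@cvgn_almost_decreasing _ 1 (u 1)) => // h H h0 H0.
have uh1 : u h <= u 1.
  have := u_scale 1 h h isT h0 h0; rewrite muln1 => /(_ (leqnn _)).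
  by rewrite divff ?mul1r // pnatr_eq0 -lt0n.
have HR : 0 < H%:R :> R by rewrite ltr0n.
(* With this [k], also [k * h <= H + h], so scaling costs at most [1 + h / H]; bounding [u h] by
   [u 1] makes the error uniform. *)
have kH : (H <= (H %/ h).+1 * h)%N by rewrite ltnW // ltn_ceil.
apply: le_trans (u_scale h H _ h0 H0 (ltn0Sn _) kH) _.
apply: (@le_trans _ _ ((1 + h%:R / H%:R) * u h)).
  apply: ler_wpM2r; first exact: u_ge0.
  rewrite (ler_pdivrMr _ _ HR) mulrDl mul1r divfK ?(gt_eqF HR) //.
  by rewrite -natrD ler_nat mulSn addnC leq_add2r leq_divM.
rewrite mulrDl mul1r lerD2l mulrC; apply: ler_wpM2r uh1.
by rewrite divr_ge0.
Qed.

(** Stated for [d]-th powers, so that counting inequalities pass to the limit without roots. *)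
Lemma lip_constP : exists2 c : R, 1 <= c & lip_const R G S = c /\
  (fun h => (card_Lip [set t]%SET h)%:R / h%:R ^+ d) @ \oo --> c ^+ d.
Proof.
have cE : lip_const R G S = limn u.
  rewrite /lip_const (n_comp_connected _ t conG) subn1.
  have [s ->] := one_per_component_set1 _ _ t conG hS.
  have st h : card_Lip [set s]%SET h = card_Lip [set t]%SET h.
    by apply/eqP; rewrite eqn_leq !card_Lip_root.
  suff -> : (fun h => h%:R^-1 * (card_Lip [set s]%SET h)%:R `^ d%:R^-1) = u.
    by [].
  by apply/funext => h; rewrite st.
exists (limn u); last split.
- apply: limr_ge; first exact: cvg_u.
  by near=> h; apply: u_ge1; near: h; exact: nbhs_infty_gt.
- exact: cE.
have -> : (fun h => (card_Lip [set t]%SET h)%:R / h%:R ^+ d) =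
    (fun h => u h ^+ d).
  by apply/funext => h; rewrite uX.
exact: (continuous_cvg _ (@exprn_continuous R d _) cvg_u).
Unshelve. all: by end_near. Qed.

End GraphLimit.

(** * Grid inequalities in the limit in [h] *)

Lemma cvg_natrV (R : realType) : (fun h : nat => h%:R^-1 : R) @ \oo --> (0 : R).
Proof. by rewrite -cvg_shiftS; exact: cvg_harmonic. Qed.

Lemma cvg_expr_fixed (R : realType) (u : R^nat) (l : R) e :
  u @ \oo --> l -> (fun h => u h ^+ e) @ \oo --> l ^+ e.
Proof. exact: (continuous_cvg _ (@exprn_continuous R e _)). Qed.

Lemma cvg_window_ratio (R : realType) :
  (fun h : nat => (2 * h).+1%:R / h%:R : R) @ \oo --> (2 : R).
Proof.
rewrite -[X in _ --> X]addr0.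
apply: (@cvg_trans _ ((fun h : nat => 2 + h%:R^-1 : R) @ \oo)); last first.
  by apply: cvgD (cvg_natrV R); exact: cvg_cst.
apply: near_eq_cvg; near=> h; rewrite -[(2 * h).+1%:R]natr1 natrM.
have h0 : h%:R != 0 :> R.
  by rewrite pnatr_eq0 -lt0n; near: h; exact: nbhs_infty_gt.
by field.
Unshelve. all: by end_near. Qed.

(** The limit is the volume of real 1-Lipschitz functions with root value in [[-1, 1]]: the free
    root contributes the factor 2. *)
Lemma cvg_lip_grid (R : realType) (n : nat) (S : {set grid n n}) :
  one_per_component (grid n n) S -> (1 < n)%N ->
  exists2 c : R, 1 <= c & lip_const R (grid n n) S = c /\
    (fun h => (lip_grid h n n)%:R / h%:R ^+ (n ^ 2)) @ \oo -->
    2 * c ^+ (n ^ 2 - 1).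
Proof.
case: n S => // n S hS n1; pose t : grid n.+1 n.+1 := (ord0, ord0).
have dE : (#|grid n.+1 n.+1|.-1 = n.+1 ^ 2 - 1)%N.
  by rewrite card_grid mulnn subn1.
have d0 : (0 < #|grid n.+1 n.+1|.-1)%N by rewrite dE; lia.
have [c c1 [cE cvg_c]] :=
  lip_constP R _ (connected_grid n.+1 n.+1) S hS t d0.
exists c => //; split; first exact: cE.
rewrite dE in cvg_c.
have -> : (fun h => (lip_grid h n.+1 n.+1)%:R / h%:R ^+ (n.+1 ^ 2) : R) =
   (fun h => (2 * h).+1%:R / h%:R * ((card_Lip [set t]%SET h)%:R /
                                      h%:R ^+ (n.+1 ^ 2 - 1)) : R).
  apply/funext => h; rewrite /lip_grid natrM -[in LHS](@subnK 1 (n.+1 ^ 2)) //.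
  by rewrite addn1 exprS invfM; ring.
by apply: cvgM cvg_c; exact: cvg_window_ratio.
Qed.

Lemma lim_lip_grid_square (R : realType) n m (bn bm : R)
    (k := ((n %/ m) ^ 2)%N) :
  (fun h => (lip_grid h n n)%:R / h%:R ^+ (n ^ 2)) @ \oo --> bn ->
  (fun h => (lip_grid h m m)%:R / h%:R ^+ (m ^ 2)) @ \oo --> bm ->
  bn <= bm ^+ k * 2 ^+ (n ^ 2 - k * m ^ 2).
Proof.
move=> cn cm; pose e := (n ^ 2 - k * m ^ 2)%N.
apply: (ler_cvg_to cn
  (cvgM (cvg_expr_fixed _ _ _ k cm)
    (cvg_expr_fixed _ _ _ e (cvg_window_ratio R)))).
near=> h; have h0 : 0 < h%:R :> R.
  by rewrite ltr0n; near: h; exact: nbhs_infty_gt.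
have km : (k * m ^ 2 <= n ^ 2)%N by rewrite /k -expnMn leq_exp2r // leq_divM.
rewrite /= !expr_div_n -exprM mulrACA -invfM -exprD (mulnC _ k) /e subnKC //.
rewrite ler_pM2r ?invr_gt0 ?exprn_gt0 //.
by rewrite -!natrX -natrM ler_nat lip_grid_square.
Unshelve. all: by end_near. Qed.

Lemma lim_lip_grid_rows (R : realType) n (b : R) :
  (fun h => (lip_grid h n.+1 n.+1)%:R / h%:R ^+ (n.+1 ^ 2)) @ \oo --> b ->
  b <= 2 ^+ n.+1 * (4 * (atan (3 / 4))^-1 ^+ n) ^+ n.
Proof.
move=> cb; set om := atan (3 / 4); have om0 : 0 < om := atan34_gt0 R.
pose r h : R := (2 * h).+1%:R / h%:R.
have cr : r @ \oo --> (2 : R) := cvg_window_ratio R.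
(* [v h] is the row eigenvalue bound [L] divided by [h]; its [+ 1] becomes [h^-1] and disappears in
   the limit. *)
pose v h : R := r h / 2 / om + h%:R^-1.
have cv : v @ \oo --> om^-1.
  have E : 2 * 2^-1 * om^-1 + 0 = om^-1 by field; rewrite gt_eqF.
  rewrite -[X in _ --> X]E; apply: cvgD (cvg_natrV R); apply: cvgM (cvg_cst _).
  exact: cvgM cr (cvg_cst _).
have cF : (fun h => r h ^+ n.+1 * (2 * r h * v h ^+ n) ^+ n) @ \oo -->
    2 ^+ n.+1 * (4 * om^-1 ^+ n) ^+ n.
  apply: cvgM; first exact: cvg_expr_fixed.
  apply: cvg_expr_fixed; apply: cvgM (cvg_expr_fixed _ _ _ n cv).
  by rewrite (_ : 4 = 2 * 2 :> R); [exact: cvgM (cvg_cst _) cr|ring].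
apply: (ler_cvg_to cb cF).
near=> h; have h0 : 0 < h%:R :> R.
  by rewrite ltr0n; near: h; exact: nbhs_infty_gt.
rewrite ler_pdivrMr ?exprn_gt0 //; apply: le_trans (lip_grid_rows R h n n) _.
rewrite le_eqVlt; apply/orP; left; apply/eqP.
have -> : h%:R ^+ (n.+1 ^ 2) = h%:R ^+ n.+1 * (h%:R * h%:R ^+ n) ^+ n :> R.
  by rewrite -exprS -exprM -exprD; congr (_ ^+ _); nia.
rewrite mulrACA -!exprMn.
congr (_ ^+ _ * _ ^+ _); first by rewrite /r divfK ?gt_eqF.
rewrite [RHS]mulrACA -exprMn -[2 * r h * _]mulrA {1}/r divfK ?gt_eqF //.
congr (_ * _ ^+ _); rewrite /v /r -/om; field.
by rewrite !gt_eqF.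
Unshelve. all: by end_near. Qed.

(** The tiling bound makes [ell], the logarithm of the volume per vertex, almost decreasing, hence
    convergent; [ln (c n)] has the same limit, which the row bound estimates. *)
Lemma cvgn_square_root (R : realType) (c b : R^nat) (lam : R) :
  0 < lam ->
  (forall n, (1 < n)%N -> 1 <= c n) ->
  (forall n, b n = 2 * c n ^+ (n ^ 2 - 1)) ->
  (forall n m (k := ((n %/ m) ^ 2)%N), (1 < n)%N -> (1 < m)%N ->
    b n <= b m ^+ k * 2 ^+ (n ^ 2 - k * m ^ 2)) ->
  (forall n, (0 < n)%N -> b n.+1 <= 2 ^+ n.+1 * (4 * lam ^+ n) ^+ n) ->
  cvgn c /\ limn c <= lam.
Proof.
move=> lam0 c1 bE bsq brow.
have b1 n : (1 < n)%N -> 1 <= b n.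
  by move=> n1; rewrite bE; have := exprn_ege1 (n ^ 2 - 1) (c1 n n1); lra.
pose ell n := ln (b n) / (n ^ 2)%:R.
have ln2 : 0 <= ln 2 :> R by rewrite ln_ge0 // ler1n.
have cvg_ell : cvgn ell.
  apply: (@cvgn_almost_decreasing _ 2 (2 * ln 2)) => // [n n1|m n m1 n1].
    by rewrite divr_ge0 // ln_ge0 // b1.
  set k := ((n %/ m) ^ 2)%N.
  have bm0 : 0 < b m by apply: lt_le_trans (b1 m m1).
  have km : (k * m ^ 2 <= n ^ 2)%N by rewrite /k -expnMn leq_exp2r // leq_divM.
  (* With [n = q * m + r] and [r < m], the uncovered area is [r * (n + q * m)], at most
     [2 * m * n]. *)
  have km' : (n ^ 2 - k * m ^ 2 <= 2 * m * n)%N.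
    rewrite /k -expnMn; have := ltn_pmod n (ltnW m1).
    rewrite {2 4}(divn_eq n m).
    move: (n %/ m)%N (n %% m)%N => q r; nia.
  have := bsq n m n1 m1; rewrite -/k -ler_ln ?posrE; last 2 first.
  - exact: lt_le_trans (b1 n n1).
  - by rewrite mulr_gt0 // exprn_gt0.
  rewrite lnM ?posrE ?exprn_gt0 // !lnXn // => H.
  have n0 : 0 < (n ^ 2)%:R :> R by rewrite ltr0n expn_gt0 (ltnW n1).
  have m0 : 0 < (m ^ 2)%:R :> R by rewrite ltr0n expn_gt0 (ltnW m1).
  rewrite /ell ler_pdivrMr // mulrDl.
  apply: le_trans H _; apply: lerD.
    rewrite mulrAC ler_pdivlMr // -[ln _ *+ _]mulr_natr -mulrA.
    rewrite ler_wpM2l ?ln_ge0 ?b1 //.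
    by rewrite -natrM ler_nat.
  rewrite (_ : 2 * ln 2 * _ * _ = ln 2 *+ (2 * m * n)).
    exact: ler_wpMn2l ln2 _ _ km'.
  rewrite -[RHS]mulr_natr !natrM; field.
  by rewrite pnatr_eq0 -lt0n ltnW.
pose l := limn ell.
(* This is [ln (c n)] for [n > 1], obtained by solving [b n = 2 * c n ^+ (n ^ 2 - 1)]. *)
pose x n := ell n + (ell n - ln 2) * ((n ^ 2)%:R - 1)^-1.
have cvg_x : x @ \oo --> l.
  rewrite -[X in _ --> X]addr0 -[X in _ --> _ + X](mulr0 (l - ln 2)).
  apply: cvgD => //; apply: cvgM; first by apply: cvgB => //; exact: cvg_cst.
  apply: (@squeeze_cvgr _ _ _ _ (fun=> 0) (fun n => n%:R^-1)).
  - near=> n; have n1 : (1 < n)%N by near: n; exact: nbhs_infty_gt.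
    have n0 : 0 < n%:R :> R by rewrite ltr0n ltnW.
    have le : n%:R <= (n ^ 2)%:R - 1 :> R.
      by rewrite lerBrDr natr1 ler_nat; nia.
    have d0 := lt_le_trans n0 le.
    by rewrite invr_ge0 ltW //= lef_pV2 ?posrE.
  - exact: cvg_cst.
  - exact: cvg_natrV.
have cvg_c : c @ \oo --> expR l.
  have : (fun n => expR (x n)) @ \oo --> expR l.
    by apply: (continuous_cvg _ (@continuous_expR R _)).
  apply: cvg_trans; apply: near_eq_cvg; near=> n.
  have n1 : (1 < n)%N by near: n; exact: nbhs_infty_gt.
  have c0 : 0 < c n by apply: lt_le_trans (c1 n n1).
  have d0 : 0 < (n ^ 2)%:R - 1 :> R by rewrite subr_gt0 ltr1n; nia.
  rewrite -[RHS]lnK ?posrE //; congr expR; rewrite /x /ell bE.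
  rewrite lnM ?posrE ?exprn_gt0 // lnXn // -[ln _ *+ _]mulr_natr.
  rewrite natrB ?expn_gt0 ?(ltnW n1) //.
  have n0 : 0 < (n ^ 2)%:R :> R by rewrite ltr0n expn_gt0 ltnW.
  by move: (n ^ 2)%:R d0 n0 => N d0 n0; field; rewrite !gt_eqF.
have le_lam : l <= ln lam.
  pose e n : R := n%:R^-1.
  (* The row bound for side [n] has logarithm [(3 * n - 2) * ln 2 + (n - 1) ^ 2 * ln lam]; drop
     [- 2 * ln 2] and divide by [n ^ 2]. *)
  pose y n := 3 * ln 2 * e n + ln lam * (1 - e n) ^+ 2.
  have cvg_y : y @ \oo --> ln lam.
    rewrite (_ : ln lam = 3 * ln 2 * 0 + ln lam * (1 - 0) ^+ 2); last first.
      by rewrite subr0 expr1n mulr1 mulr0 add0r.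
    have ce : e @ \oo --> (0 : R) := cvg_natrV R.
    apply: cvgD; first by apply: cvgM => //; exact: cvg_cst.
    apply: cvgM; first exact: cvg_cst.
    apply: cvg_expr_fixed; apply: cvgB => //; exact: cvg_cst.
  suff ell_y n : (0 < n)%N -> ell n.+1 <= y n.+1.
    apply: (ler_cvg_to cvg_ell cvg_y); near=> n.
    have n1 : (1 < n)%N by near: n; exact: nbhs_infty_gt.
    by have := ell_y n.-1; rewrite prednK ?(ltnW n1) //; apply; lia.
  move=> n1; have := brow n n1.
  rewrite -ler_ln ?posrE; last 2 first.
  - exact: lt_le_trans (b1 n.+1 n1).
  - by rewrite mulr_gt0 ?exprn_gt0 // mulr_gt0 ?exprn_gt0.
  have p0 : 0 < 4 * lam ^+ n by rewrite mulr_gt0 ?exprn_gt0.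
  rewrite lnM ?posrE ?exprn_gt0 // !lnXn // lnM ?posrE ?exprn_gt0 // lnXn //.
  rewrite (_ : 4 = 2 ^+ 2 :> R) ?lnXn //; last by ring.
  have N0 : 0 < n.+1%:R :> R by rewrite ltr0n.
  rewrite /ell natrX ler_pdivrMr ?exprn_gt0 // => H; apply: le_trans H _.
  rewrite (_ : y _ * _ = 3 * ln 2 * n.+1%:R + ln lam * n%:R ^+ 2); last first.
    have -> : n%:R = n.+1%:R - 1 :> R by rewrite -natr1 addrK.
    by rewrite /y /e; move: n.+1%:R N0 => N N0; field; rewrite gt_eqF.
  rewrite -[ln 2 *+ n.+1]mulr_natr -[(_ + _) *+ n]mulr_natr.
  rewrite -[ln lam *+ n]mulr_natr.
  rewrite -[n.+1%:R]natr1; move: (ln 2) (ln lam) ln2 => a c' a0.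
  rewrite -subr_ge0 (_ : _ - _ = 2 * a) ?mulr_ge0 //; by ring.
split; first by apply/cvg_ex; exists (expR l).
by rewrite (cvg_lim _ cvg_c) // -[leRHS]lnK ?posrE // ler_expR.
Unshelve. all: by end_near. Qed.

Theorem theorem2p1p4 (R : realType) (S : forall n : nat, {set grid n n})
    (hS : forall n : nat, one_per_component (grid n n) (S n)) :
  let c : R^nat := fun n => lip_const R (grid n n) (S n) in
  cvgn c /\ limn c <= (atan (3 / 4))^-1.
Proof.
move=> c.
(* The condition [1 < n] ensures that the grid has an edge, so that the root exponent is
   meaningful. *)
have cP n : (1 < n)%N -> 1 <= c n /\
    (fun h => (lip_grid h n n)%:R / h%:R ^+ (n ^ 2)) @ \oo -->
    2 * c n ^+ (n ^ 2 - 1).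
  move=> n1; have [x x1 [xE cvg_x]] := cvg_lip_grid R n (S n) (hS n) n1.
  by rewrite /c xE.
apply: (cvgn_square_root _ _ (fun n => 2 * c n ^+ (n ^ 2 - 1))) => //.
- by rewrite invr_gt0 atan34_gt0.
- by move=> n /cP[].
- by move=> n m k /cP[_ cn] /cP[_ cm]; exact: lim_lip_grid_square cn cm.
- by move=> n n0; have [_ cn] := cP n.+1 n0; exact: lim_lip_grid_rows cn.
Qed.
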